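(* Let $k,n$ be positive integers and $m=(n-1)k+1$. The order complex $\Delta(\Pi^{(k)}_m)$ is a subdivision of the complex of $k$-trees $\mathcal{T}^k_n$.
   Context: $\Pi^{(k)}_m$ is the poset of set partitions of $\{1,\dots,m\}$ all of whose block sizes are congruent to $1$ modulo $k$, ordered by refinement (coarser partitions are larger); it has a minimal element (all singletons) and a maximal element (the single block $\{1,\dots,m\}$). $\Delta(\Pi^{(k)}_m)$ denotes the order complex of its proper part, i.e. the simplicial complex of nonempty chains of elements different from the minimal and maximal element. The complex of $k$-trees $\mathcal{T}^k_n$ is the abstract simplicial complex whose faces are the combinatorial types of rooted trees with $m$ leaves labelled $1,\dots,m$ in which every internal vertex has outdegree larger than $1$ and congruent to $1$ modulo $k$; a tree $T_2$ is a face of $T_1$ iff $T_2$ is obtained from $T_1$ by contracting a set of internal edges. (Equivalently, a tree is identified with the set $\{\ell(t)\}$, where $t$ ranges over the non-root internal vertices and $\ell(t)$ is the set of leaves below $t$; faces correspond to subsets.) For simplicial complexes $P,Q$ with face posets $\mathscr{F}(P),\mathscr{F}(Q)$, $P$ is a subdivision of $Q$ if there is a poset map $\phi:\mathscr{F}(P)\to\mathscr{F}(Q)$ and an injective map $f^0:V(P)\to|Q|$ from the vertex set of $P$ to the geometric realization of $Q$ such that for every simplex $p$ of $P$ the vertices of $p$ are mapped into the closed simplex $|\phi(p)|$, and the affine-linear extension $f:|P|\to|Q|$ of $f^0$ is a homeomorphism. *)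

(* Defs.v *)
From HB Require Import structures.
From mathcomp Require Import boolp classical_sets functions reals topology normedtype.
(* Imported last, so that [set0], [partition], ... are those of finset. *)
From mathcomp Require Import all_boot all_order all_algebra.

Set Implicit Arguments.
Unset Strict Implicit.
Unset Printing Implicit Defensive.

Import Order.TTheory GRing.Theory Num.Theory.
Import numFieldNormedType.Exports.

Local Open Scope classical_set_scope.
Local Open Scope ring_scope.

(* The empty simplex is not a face. A point of [V] need not be a vertex: the
   vertices are the [v] whose singleton is a face. *)
Record simplicial_complex (V : finType) := SimplicialComplex {
  face :> {set V} -> Prop;
  face_neq0 : forall s : {set V}, face s -> s != set0;
  face_sub : forall s t : {set V}, face s -> t \subset s -> t != set0 -> face t
}.

Definition vertices (V : finType) (P : simplicial_complex V) : set V :=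
  [set v | P (set1 v)]%classic.

Definition closed_simplex (R : realType) (V : finType) (s : {set V}) :
    set {ptws V -> R} :=
  [set x | [/\ forall v, 0 <= x v, \sum_v x v = 1
             & forall v, v \notin s -> x v = 0]]%classic.
Arguments closed_simplex R {V} s.

(* The topology is the one induced by the product topology on [V -> R]. *)
Definition realization (R : realType) (V : finType) (P : simplicial_complex V) :
    set {ptws V -> R} :=
  (\bigcup_(s in [set s | P s]) closed_simplex R s)%classic.
Arguments realization R {V} P.

Definition homeomorphism (X Y : topologicalType) (A : set X) (B : set Y)
    (f : X -> Y) : Prop :=
  [/\ set_fun A B f, {within A, continuous f}
    & exists g : Y -> X,
      [/\ set_fun B A g, {within B, continuous g},
          {in A, cancel f g} & {in B, cancel g f}]].

(* On [realization R P] only the values of [f0] on the vertices of [P] matter,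
   since the barycentric coordinates at all other [v] vanish. *)
Definition affine_extension (R : realType) (V W : finType)
    (f0 : V -> {ptws W -> R}) (x : {ptws V -> R}) : {ptws W -> R} :=
  fun w => \sum_v x v * f0 v w.

Definition is_subdivision (R : realType) (V W : finType)
    (P : simplicial_complex V) (Q : simplicial_complex W) : Prop :=
  exists (phi : {set V} -> {set W}) (f0 : V -> {ptws W -> R}),
  [/\ (forall p, P p -> Q (phi p))
        /\ (forall p q : {set V}, P p -> P q -> p \subset q -> phi p \subset phi q),
      set_fun (vertices P) (realization R Q) f0,
      set_inj (vertices P) f0,
      forall p : {set V}, P p -> forall v, v \in p -> closed_simplex R (phi p) (f0 v)
    & homeomorphism (realization R P) (realization R Q) (affine_extension f0)].

Section OrderComplex.
Context {d : Order.disp_t} (T : finPOrderType d).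
Implicit Types s t : {set T}.
Local Open Scope order_scope.

Definition proper_part : {set T} :=
  [set x : T | ~~ [forall y, x <= y] & ~~ [forall y, y <= x]]%SET.

Definition order_complex_face (s : {set T}) : Prop :=
  [/\ s != set0, s \subset proper_part & {in s &, forall x y, x >=< y}].

Lemma order_complex_face_neq0 s : order_complex_face s -> s != set0.
Proof. by case. Qed.

Lemma order_complex_face_sub s t : order_complex_face s ->
  t \subset s -> t != set0 -> order_complex_face t.
Proof.
move=> [_ sP sC] ts t0; split=> //; first exact: subset_trans ts sP.
by move=> x y xt yt; apply: sC; apply: (subsetP ts).
Qed.

Definition order_complex : simplicial_complex T :=
  SimplicialComplex order_complex_face_neq0 order_complex_face_sub.

End OrderComplex.

Section Partitions.
Variables k m : nat.
Local Open Scope nat_scope.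

Definition is_kpartition (P : {set {set 'I_m}}) : bool :=
  partition P [set: 'I_m]%SET && [forall B in P, #|B| == 1 %[mod k]].

Record kpartition := KPartition {
  blocks : {set {set 'I_m}};
  blocksP : is_kpartition blocks
}.

HB.instance Definition _ := [isSub for blocks].
HB.instance Definition _ := [Finite of kpartition by <:].

Definition refines (P Q : kpartition) : bool :=
  [forall B in blocks P, [exists C in blocks Q, B \subset C]].

Lemma refinesP P Q :
  reflect (forall B, B \in blocks P -> exists2 C, C \in blocks Q & B \subset C)
          (refines P Q).
Proof.
apply: (iffP 'forall_implyP) => PQ B /PQ; first by move/exists_inP.
by move=> BC; apply/exists_inP.
Qed.

Lemma refines_refl : reflexive refines.
Proof. by move=> P; apply/refinesP => B BP; exists B. Qed.

Lemma refines_trans : transitive refines.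
Proof.
move=> Q P S /refinesP PQ /refinesP QS; apply/refinesP => B /PQ[C /QS[D DS CD] BC].
by exists D => //; apply: subset_trans CD.
Qed.

Lemma refines_sub P Q : refines P Q -> refines Q P -> blocks P \subset blocks Q.
Proof.
move=> /refinesP PQ /refinesP QP; apply/subsetP => B BP.
have [C CQ BC] := PQ _ BP; have [B' B'P CB'] := QP _ CQ.
have /andP[/and3P[_ /trivIsetP tI nB] _] := blocksP P.
suff BB' : B = B' by have -> : B = C by apply/eqP; rewrite eqEsubset BC BB'.
apply/eqP; apply: contraT => /(tI _ _ BP B'P).
rewrite -setI_eq0 (setIidPl (subset_trans BC CB')) => /eqP B0.
by rewrite B0 in BP; rewrite BP in nB.
Qed.

Lemma refines_anti : antisymmetric refines.
Proof.
move=> P Q /andP[PQ QP]; apply/val_inj/eqP.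
by rewrite eqEsubset !refines_sub.
Qed.

Fact refinement_display : Order.disp_t. Proof. exact: Order.Disp tt tt. Qed.

HB.instance Definition _ := Order.Le_isPOrder.Build refinement_display kpartition
  refines_refl refines_anti refines_trans.

Lemma kpartition_leastP (P : kpartition) :
  (forall Q : kpartition, (P <= Q)%O) <-> blocks P = [set [set i] | i : 'I_m]%SET.
Proof.
pose S := [set [set i] | i : 'I_m]%SET.
have SP : is_kpartition S.
  apply/andP; split; last first.
    by apply/'forall_implyP => _ /imsetP[i _ ->]; rewrite cards1.
  apply/and3P; split.
  - rewrite /cover eqEsubset subsetT; apply/subsetP => i _.
    by apply/bigcupP; exists [set i]%SET; rewrite ?inE ?imset_f.
  - apply/trivIsetP => _ _ /imsetP[i _ ->] /imsetP[j _ ->] ij.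
    rewrite disjoints1 inE; apply: contra ij => /eqP ->; exact: eqxx.
  - by apply/imsetP => -[i _ /setP/(_ i)]; rewrite !inE eqxx.
split=> [Pmin|PS Q]; last first.
  apply/refinesP => B; rewrite PS => /imsetP[i _ ->].
  have /andP[/cover_partition Q1 _] := blocksP Q.
  have : i \in cover (blocks Q) by rewrite Q1 inE.
  by case/bigcupP => C CQ iC; exists C; rewrite ?sub1set.
have le1 := Pmin (KPartition SP).
suff le2 : refines (KPartition SP) P.
  by apply/eqP; rewrite eqEsubset (refines_sub le1 le2) (refines_sub le2 le1).
apply/refinesP => B /imsetP[i _ ->].
have /andP[/cover_partition Q1 _] := blocksP P.
have : i \in cover (blocks P) by rewrite Q1 inE.
by case/bigcupP => C CQ iC; exists C; rewrite ?sub1set.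
Qed.

Lemma kpartition_greatestP (P : kpartition) : 0 < m -> m = 1 %[mod k] ->
  (forall Q : kpartition, (Q <= P)%O) <-> blocks P = [set [set: 'I_m]]%SET.
Proof.
move=> m0 m1; pose S := [set [set: 'I_m]]%SET.
have SP : is_kpartition S.
  apply/andP; split; last first.
    by apply/'forall_implyP => _ /set1P ->; rewrite cardsT card_ord m1.
  apply/and3P; split.
  - by rewrite /cover big_set1.
  - by apply/trivIsetP => _ _ /set1P -> /set1P ->; rewrite eqxx.
  - by apply/set1P => /setP/(_ (Ordinal m0)); rewrite !inE.
have leS (Q : kpartition) : refines Q (KPartition SP).
  apply/refinesP => B _; exists [set: 'I_m]%SET; rewrite ?subsetT //.
  exact/set1P.
split=> [Pmax|PS Q].
  have le := Pmax (KPartition SP).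
  by apply/eqP; rewrite eqEsubset (refines_sub (leS _) le) (refines_sub le (leS _)).
have -> : P = KPartition SP by exact: val_inj.
exact: leS.
Qed.

End Partitions.

(* Plane trees; the order of the children is forgotten when a tree is replaced
   by its set of clusters. *)
Inductive tree (T : Type) : Type :=
  | Leaf of T
  | Node of seq (tree T).
Arguments Leaf {T}.
Arguments Node {T}.

Section Trees.
Variable T : finType.
Implicit Types (t : tree T) (s : seq (tree T)).

Fixpoint leaves t : seq T :=
  match t with Leaf i => [:: i] | Node s => flatten (map leaves s) end.

Definition cluster t : {set T} := [set i in leaves t]%SET.

Fixpoint internal t : seq (tree T) :=
  match t with
  | Leaf _ => [::]
  | Node s => t :: flatten (map internal s)
  end.

Definition nonroot_internal t : seq (tree T) := behead (internal t).

Definition clusters t : {set {set T}} :=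
  [set C in map cluster (nonroot_internal t)]%SET.

Fixpoint outdegrees_ok (k : nat) t : bool :=
  match t with
  | Leaf _ => true
  | Node s => [&& (1 < size s)%N, size s == 1 %[mod k] & all (outdegrees_ok k) s]
  end.

(* The leaves are labelled bijectively by [T]. *)
Definition is_ktree (k : nat) t : bool :=
  perm_eq (leaves t) (enum T) && outdegrees_ok k t.

(* [contract p t] contracts the edge above each non-root internal vertex whose
   cluster satisfies [p]; distinct vertices of a k-tree have distinct clusters. *)
Fixpoint splice (p : pred {set T}) t : seq (tree T) :=
  match t with
  | Leaf _ => [:: t]
  | Node s => let s' := flatten (map (splice p) s) in
              if p (cluster t) then s' else [:: Node s']
  end.

Definition contract (p : pred {set T}) t : tree T :=
  match t with
  | Leaf _ => t
  | Node s => Node (flatten (map (splice p) s))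
  end.

Fixpoint tree_all_ind (P : tree T -> Prop)
    (PL : forall i, P (Leaf i))
    (PN : forall s, foldr (fun t Q => P t /\ Q) True s -> P (Node s)) t : P t :=
  match t with
  | Leaf i => PL i
  | Node s => PN s
      ((fix loop s : foldr (fun t Q => P t /\ Q) True s :=
         match s with
         | [::] => I
         | t :: s' => conj (tree_all_ind PL PN t) (loop s')
         end) s)
  end.

Lemma leaves_splice p t : flatten (map leaves (splice p t)) = leaves t.
Proof.
elim/tree_all_ind: t => [//|s IH] /=.
have {}IH : flatten (map leaves (flatten (map (splice p) s)))
    = flatten (map leaves s).
  by elim: s IH => //= t s IHs [Ht /IHs <-]; rewrite map_cat flatten_cat Ht.
by case: ifP => _ //=; rewrite IH cats0.
Qed.

Lemma leaves_splices p s :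
  flatten (map leaves (flatten (map (splice p) s))) = flatten (map leaves s).
Proof. by elim: s => //= t s <-; rewrite map_cat flatten_cat leaves_splice. Qed.

Lemma leaves_contract p t : leaves (contract p t) = leaves t.
Proof. by case: t => //= s; apply: leaves_splices. Qed.

Lemma internal_splice p t :
  map cluster (flatten (map internal (splice p t)))
    = [seq C <- map cluster (internal t) | ~~ p C].
Proof.
elim/tree_all_ind: t => [//|s IH] /=.
have {}IH : map cluster (flatten (map internal (flatten (map (splice p) s))))
    = [seq C <- map cluster (flatten (map internal s)) | ~~ p C].
  elim: s IH => //= t s IHs [Ht /IHs E].
  by rewrite !map_cat flatten_cat !map_cat filter_cat Ht E.
case: ifP => _ //=; rewrite cats0 IH; congr (_ :: _).
by rewrite /cluster /= leaves_splices.
Qed.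

Lemma clusters_contract p t :
  clusters (contract p t) = [set C in clusters t | ~~ p C]%SET.
Proof.
apply/setP => C; rewrite !inE; case: t => //= s.
rewrite /nonroot_internal /= andbC.
set cs := map cluster (flatten (map internal s)).
rewrite -[RHS](mem_filter (fun D => ~~ p D) C cs) {}/cs; congr (_ \in _).
elim: s => //= t s IHs.
by rewrite !map_cat flatten_cat !map_cat filter_cat internal_splice IHs.
Qed.

Lemma outdegrees_ok_splice k p t : outdegrees_ok k t ->
  [/\ all (outdegrees_ok k) (splice p t), (0 < size (splice p t))%N
    & size (splice p t) = 1 %[mod k]].
Proof.
elim/tree_all_ind: t => [//|s IH] /= /and3P[s1 /eqP sk sok].
have {sok IH} [H1 H2 H3] : [/\ all (outdegrees_ok k) (flatten (map (splice p) s)),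
    (size s <= size (flatten (map (splice p) s)))%N
    & size (flatten (map (splice p) s)) = size s %[mod k]].
  elim: s sok IH {s1 sk} => //= t s IHs /andP[tok sok] [Ht Hs].
  have [H1 H2 H3] := IHs sok Hs; have [G1 G2 G3] := Ht tok.
  rewrite all_cat G1 H1 size_cat; split=> //.
    by rewrite -add1n leq_add.
  by rewrite -modnDm G3 H3 modnDm add1n.
case: ifP => _; first by split; [|exact: leq_trans (ltnW s1) H2|rewrite H3].
by split=> //=; rewrite H1 (leq_trans s1 H2) H3 sk eqxx.
Qed.

Lemma is_ktree_contract k p t : is_ktree k t -> is_ktree k (contract p t).
Proof.
rewrite /is_ktree leaves_contract => /andP[-> /=].
case: t => //= s /and3P[s1 /eqP sk sok].
have [H1 H2 H3] : [/\ all (outdegrees_ok k) (flatten (map (splice p) s)),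
    (size s <= size (flatten (map (splice p) s)))%N
    & size (flatten (map (splice p) s)) = size s %[mod k]].
  elim: s sok {s1 sk} => //= t s IHs /andP[tok sok].
  have [H1 H2 H3] := IHs sok; have [G1 G2 G3] := outdegrees_ok_splice p tok.
  rewrite all_cat G1 H1 size_cat; split=> //.
    by rewrite -add1n leq_add.
  by rewrite -modnDm G3 H3 modnDm add1n.
by rewrite H1 (leq_trans s1 H2) H3 sk eqxx.
Qed.

(* A tree is identified with its set of clusters. By [clusters_contract] the
   subsets of [clusters t] are the cluster sets of the contractions of [t]. The
   tree without internal edges corresponds to the empty simplex. *)
Definition ktree_face (k : nat) (X : {set {set T}}) : Prop :=
  X != set0 /\ exists2 t, is_ktree k t & X = clusters t.

Lemma ktree_face_neq0 k (X : {set {set T}}) : ktree_face k X -> X != set0.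
Proof. by case. Qed.

Lemma ktree_face_sub k (X Y : {set {set T}}) : ktree_face k X -> Y \subset X ->
  Y != set0 -> ktree_face k Y.
Proof.
move=> [_ [t tk ->]] Yt Y0; split=> //.
exists (contract (fun C => C \notin Y) t); first exact: is_ktree_contract.
rewrite clusters_contract; apply/setP => C; rewrite inE negbK andbC.
by case: (boolP (C \in Y)) => //= CY; rewrite (subsetP Yt _ CY).
Qed.

End Trees.

Definition ktree_complex (k n : nat) :
    simplicial_complex {set 'I_((n - 1) * k + 1)} :=
  SimplicialComplex (@ktree_face_neq0 _ k) (@ktree_face_sub _ k).

(* Main.v *)
(* Faces of the complex of k-trees are the nonempty laminar families of proper
   clusters of size > 1 and = 1 mod k. The vertex map sends a partition to the
   barycenter of its nontrivial blocks, and a chain to the union of its sets of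
   nontrivial blocks. For a chain with weights, the weight of a cluster is the
   total weight of the partitions having it as a block, up to rescaling each
   partition by its number of nontrivial blocks. The maximal clusters of
   positive weight are the nontrivial blocks of the top of the chain; peeling
   them off shows that chains with positive weights correspond bijectively to
   laminar families with positive weights. The inverse is continuous by
   compactness. *)
From mathcomp Require Import boolp classical_sets functions reals topology normedtype.
From mathcomp Require Import all_boot all_order all_algebra.
Require Import Defs.

Set Implicit Arguments.
Unset Strict Implicit.
Unset Printing Implicit Defensive.

Import Order.TTheory GRing.Theory Num.Theory.
Import numFieldNormedType.Exports.

Local Open Scope ring_scope.

(** * Laminar families and the partition formed by their maximal members *)

Section Laminar.
Variable T : finType.
Implicit Types (A B C : {set T}) (X Y : {set {set T}}) (t : tree T).
Local Open Scope nat_scope.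
Local Open Scope set_scope.

Definition laminar X : Prop :=
  {in X &, forall B C, [|| B \subset C, C \subset B | [disjoint B & C]]}.

Lemma laminarS X Y : Y \subset X -> laminar X -> laminar Y.
Proof. by move=> /subsetP YX lX B C /YX BX /YX; apply: lX. Qed.

Definition tops X : {set {set T}} := [set B | maxset [in X] B].

Lemma topsP X B : reflect (B \in X /\ forall C, C \in X -> B \subset C -> C = B)
  (B \in tops X).
Proof. by rewrite inE; apply: maxsetP. Qed.

Lemma tops_exists X C : C \in X -> exists2 B, B \in tops X & C \subset B.
Proof. by case/maxset_exists=> B ? ?; exists B; rewrite ?inE. Qed.

(** The singletons fill whatever [X] leaves uncovered in [A]; a singleton strictly inside a member
    of [X] is not maximal and drops out. *)
Definition tops_partition_of A X : {set {set T}} :=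
  tops (X :|: [set [set i] | i in A]).

Lemma laminar_singletons A X : laminar X -> laminar (X :|: [set [set i] | i in A]).
Proof.
have single i B : [|| [set i] \subset B, B \subset [set i] | [disjoint [set i] & B]].
  by rewrite sub1set disjoints1; case: (i \in B); rewrite ?orbT.
move=> lX B C /setUP[BX|/imsetP[i _ ->]] /setUP[CX|/imsetP[j _ ->]] //.
- exact: lX.
- by rewrite orbCA disjoint_sym.
Qed.

(** Two members of a laminar family are nested or disjoint, and nesting of distinct sets contradicts
    maximality. The union is all of [A] because each point has its singleton below some maximal
    member. *)
Lemma tops_partition_ofP A X : laminar X ->
  {in X, forall C, C != set0 /\ C \subset A} -> partition (tops_partition_of A X) A.
Proof.
move=> lX XA; pose Y := X :|: [set [set i] | i in A].
have lY : laminar Y by exact: laminar_singletons.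
have YA C : C \in Y -> C != set0 /\ C \subset A.
  case/setUP => [/XA //|/imsetP[i iA ->]]; rewrite sub1set; split=> //.
  by apply/set0Pn; exists i; rewrite inE.
apply/and3P; split.
- rewrite eqEsubset; apply/andP; split.
    by apply/bigcupsP => C /topsP[/YA[]].
  apply/subsetP => i iA; have /tops_exists[B BY iB] : [set i] \in Y.
    by rewrite inE imset_f ?orbT.
  by apply/bigcupP; exists B => //; rewrite -sub1set.
- apply/trivIsetP => B C /topsP[BY Bmax] /topsP[CY Cmax] BC.
  case/or3P: (lY _ _ BY CY) => // s; first by rewrite (Bmax _ CY s) eqxx in BC.
  by rewrite (Cmax _ BY s) eqxx in BC.
- by apply/topsP => -[/YA[/eqP]].
Qed.

Lemma tops_partition_ofE A X B : 1 < #|B| ->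
  (B \in tops_partition_of A X) = (B \in tops X).
Proof.
move=> B1; apply/topsP/topsP => -[+ Bmax].
  case/setUP => [BX|/imsetP[i _ Bi]]; last by rewrite Bi cards1 in B1.
  by split=> // C CX; apply: Bmax; rewrite inE CX.
move=> BX; split=> [|C]; first by rewrite inE BX.
case/setUP => [/Bmax //|/imsetP[i _ ->] /subset_leq_card].
by rewrite cards1 leqNgt B1.
Qed.

(** Every block is a singleton or a member of [X], so each contributes 1 modulo [k]. This gives the
    outdegree of a vertex whose children are the blocks. *)
Lemma card_tops_partition_of k A X :
  partition (tops_partition_of A X) A -> {in X, forall C, #|C| = 1 %[mod k]} ->
  #|A| = #|tops_partition_of A X| %[mod k].
Proof.
move=> /card_partition -> Xk; rewrite -modn_summ -[in RHS]sum1_card -[in RHS]modn_summ.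
congr (_ %% _); apply: eq_bigr => B /topsP[/setUP[/Xk //|/imsetP[i _ ->]] _].
by rewrite cards1.
Qed.

(** * From trees to laminar families of clusters *)

Lemma internalE t : internal t = [::] \/ internal t = t :: nonroot_internal t.
Proof. by case: t => [i|s]; [left|right]. Qed.

Lemma mem_map_internal_Node (s : seq (tree T)) C :
  (C \in map (@cluster T) (flatten (map (@internal T) s))) =
  has (fun t => C \in map (@cluster T) (internal t)) s.
Proof. by elim: s => //= t s <-; rewrite map_cat mem_cat. Qed.


Definition kcluster k A C : bool := [&& 1 < #|C|, #|C| == 1 %[mod k] & C \subset A].

(** The [foldr] premise is the induction hypothesis of [tree_all_ind] for the children. Clusters in
    different trees are disjoint. The last bound holds because each tree not containing [C] has at
    least one leaf; it later makes clusters below the root proper. *)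
Lemma internal_forest k (s : seq (tree T)) (L := flatten (map (@leaves T) s))
    (X := [set C in map (@cluster T) (flatten (map (@internal T) s))]) :
  foldr (fun t Q => (uniq (leaves t) -> outdegrees_ok k t ->
    [/\ 0 < size (leaves t), size (leaves t) = 1 %[mod k],
        laminar [set C in map (@cluster T) (internal t)]
      & {in map (@cluster T) (internal t), forall C, kcluster k (cluster t) C}]) /\ Q) True s ->
  uniq L -> all (outdegrees_ok k) s ->
  [/\ size s <= size L, size L = size s %[mod k], laminar X
    & {in X, forall C, kcluster k [set i in L] C /\ #|C| + size s <= (size L).+1}].
Proof.
rewrite {}/L {}/X; elim: s => [_ _ _|t s IHs [IHt IH]] /=.
  by split=> // [B C|B]; rewrite inE.
rewrite cat_uniq => /and3P[ut /hasPn ts us] /andP[tok sok].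
have [t0 tk tlam tX] := IHt ut tok.
have [s0 sk slam sX] := IHs IH us sok.
have XE C : (C \in [set D in map (@cluster T) (internal t ++ flatten (map (@internal T) s))]) =
    (C \in [set D in map (@cluster T) (internal t)])
    || (C \in [set D in map (@cluster T) (flatten (map (@internal T) s))]).
  by rewrite !inE map_cat mem_cat.
have disj B C : B \in [set D in map (@cluster T) (internal t)] ->
    C \in [set D in map (@cluster T) (flatten (map (@internal T) s))] -> [disjoint B & C].
  rewrite inE => /tX/and3P[_ _ Bt] /sX[/and3P[_ _ Cs] _].
  apply: disjointWl Bt _; apply: disjointWr Cs _.
  rewrite -setI_eq0; apply/eqP/setP => i; rewrite !inE; apply/negP => /andP[it /ts].
  by rewrite it.
split.
- by rewrite size_cat -add1n leq_add.
- by rewrite size_cat -modnDm tk sk modnDm add1n.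
- move=> B C; rewrite !XE => /orP[Bt|Bs] /orP[Ct|Cs].
  + exact: tlam.
  + by rewrite disj ?orbT.
  + by rewrite disjoint_sym disj ?orbT.
  + exact: slam.
- move=> C; rewrite XE => /orP[|/sX[/and3P[C1 Ck Cs] Csz]].
    rewrite inE => /tX/and3P[C1 Ck Ct]; split.
      rewrite /kcluster C1 Ck; apply: subset_trans Ct _.
      by apply/subsetP => i; rewrite !inE mem_cat => ->.
    have /leq_trans := subset_leq_card Ct => /(_ (size (leaves t))).
    rewrite cardsE (card_uniqP ut) => /(_ (leqnn _)) Csz.
    by rewrite size_cat addnS ltnS leq_add.
  split.
    rewrite /kcluster C1 Ck; apply: subset_trans Cs _.
    by apply/subsetP => i; rewrite !inE mem_cat orbC => ->.
  rewrite size_cat addnS; apply: leq_ltn_trans Csz _.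
  by rewrite ltnS -addn1 addnC leq_add2r.
Qed.

Lemma internal_tree k t : uniq (leaves t) -> outdegrees_ok k t ->
  [/\ 0 < size (leaves t), size (leaves t) = 1 %[mod k],
      laminar [set C in map (@cluster T) (internal t)]
    & {in map (@cluster T) (internal t), forall C, kcluster k (cluster t) C}].
Proof.
elim/tree_all_ind: t => [i _ _|s IH ut /= /and3P[s1 /eqP sk sok]].
  by split=> // B C; rewrite inE.
have [Ls Lk lam X] := internal_forest IH ut sok.
have L1 : 1 < size (flatten (map (@leaves T) s)) := leq_trans s1 Ls.
have XE C : (C \in map (@cluster T) (internal (Node s))) =
    (C == cluster (Node s)) || (C \in [set D in map (@cluster T) (flatten (map (@internal T) s))]).
  by rewrite /= in_cons in_set.
have cE : #|cluster (Node s)| = size (flatten (map (@leaves T) s)).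
  by rewrite cardsE (card_uniqP ut).
have subN C : C \in [set D in map (@cluster T) (flatten (map (@internal T) s))] ->
    C \subset cluster (Node s).
  by case/X => /and3P[].
split.
- exact: ltnW.
- by rewrite Lk.
- move=> B C; rewrite !in_set !XE => /orP[/eqP->|Bs] /orP[/eqP->|Cs].
  + by rewrite subxx.
  + by rewrite subN ?orbT.
  + by rewrite subN.
  + exact: lam.
- move=> C; rewrite XE => /orP[/eqP->|/X[]//].
  by rewrite /kcluster cE L1 Lk sk eqxx /=.
Qed.

(** The root has at least two children, so the cardinality bound of [internal_forest] leaves a leaf
    outside [C]. *)
Lemma nonroot_internal_proper k t : uniq (leaves t) -> outdegrees_ok k t ->
  {in map (@cluster T) (nonroot_internal t), forall C, C \proper cluster t}.
Proof.
case: t => [//|s] ut /= /and3P[s1 sk sok] C.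
have IH : foldr (fun t Q => (uniq (leaves t) -> outdegrees_ok k t ->
    [/\ 0 < size (leaves t), size (leaves t) = 1 %[mod k],
        laminar [set C in map (@cluster T) (internal t)]
      & {in map (@cluster T) (internal t), forall C, kcluster k (cluster t) C}]) /\ Q) True s.
  by elim: s {ut s1 sk sok} => //= t s; split=> //; apply: internal_tree.
have [_ _ _ X] := internal_forest IH ut sok.
have {}X := X C; rewrite inE in X => /X[/and3P[_ _ Csub] Csz].
rewrite properEcard Csub cardsE (card_uniqP ut) /=.
by rewrite -ltnS (leq_trans _ Csz) // -addn2 leq_add2l.
Qed.

(** * From laminar families to trees *)

(** Induction on the size of [A]: the maximal members of [Y] other than [A], with the uncovered
    singletons, become the children of the root. The last premise reflects that a tree with more
    than one leaf has an internal root, whose cluster is [A]. *)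
Lemma kcluster_tree_exists k A Y : A != set0 -> #|A| = 1 %[mod k] -> laminar Y ->
  {in Y, forall C, kcluster k A C} -> (1 < #|A| -> A \in Y) ->
  exists t, [/\ perm_eq (leaves t) (enum A), outdegrees_ok k t
              & [set C in map (@cluster T) (internal t)] = Y].
Proof.
have [n] := ubnP #|A|; elim: n => // n IHn in A Y *.
rewrite ltnS => An A0 Ak lY YA AY.
have [A1|A1] := leqP #|A| 1.
  have /eqP/cards1P[i Ai] : #|A| = 1 by apply/eqP; rewrite eqn_leq A1 card_gt0.
  exists (Leaf i); split=> //=; first by rewrite Ai enum_set1.
  apply/setP => C; rewrite !inE; apply/esym/negP => /YA/and3P[C1 _ CA].
  by have := leq_trans C1 (leq_trans (subset_leq_card CA) A1).
pose X := Y :\ A; pose P := tops_partition_of A X.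
have XY : X \subset Y by rewrite subD1set.
have XA : {in X, forall C, C != set0 /\ C \subset A}.
  move=> C /(subsetP XY)/YA/and3P[C1 _ CA]; split=> //.
  by rewrite -card_gt0 ltnW.
have partP : partition P A by apply: tops_partition_ofP => //; apply: laminarS lY.
have /and3P[/eqP covP tiP P0] := partP.
have Xk : {in X, forall C, #|C| = 1 %[mod k]}.
  by move=> C /(subsetP XY)/YA/and3P[_ /eqP].
(* [A] was removed from [Y], so no block is all of [A]. This makes the induction decrease and later
   forces at least two children. *)
have PA B : B \in P -> B \proper A.
  move=> BP; have BA : B \subset A by rewrite -covP bigcup_sup.
  rewrite properEneq BA andbT; apply/eqP => BA'; subst B.
  by have := BP; rewrite tops_partition_ofE // => /topsP[]; rewrite !inE eqxx.
have Bk B : B \in P -> #|B| = 1 %[mod k].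
  by case/topsP=> /setUP[/Xk //|/imsetP[i _ ->]]; rewrite cards1.
(* The membership in [P] stands under the existential so that [choice] yields a total function;
   outside [P] the tree is an arbitrary leaf. *)
have treeB B : exists t, B \in P -> [/\ perm_eq (leaves t) (enum B), outdegrees_ok k t
              & [set C in map (@cluster T) (internal t)] = [set C in Y | C \subset B]].
  case: (boolP (B \in P)) => BP; last first.
    by have /set0Pn[i _] := A0; exists (Leaf i).
  have [||||||t] := IHn B [set C in Y | C \subset B].
  - exact: leq_trans (proper_card (PA B BP)) An.
  - by apply: contraNneq P0 => <-.
  - exact: Bk.
  - by apply: laminarS lY; apply/subsetP => C; rewrite inE => /andP[].
  - move=> C; rewrite inE => /andP[/YA/and3P[C1 Ck _] CB].
    by rewrite /kcluster C1 Ck.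
  - move=> B1; rewrite inE subxx andbT.
    by have := BP; rewrite tops_partition_ofE // => /topsP[/(subsetP XY)].
  by exists t.
have /choice[tr trP] := treeB.
(* Occurrences of a leaf are summed over the blocks; as these are disjoint with union [A], the
   double sum becomes one over [A]. *)
have permN : perm_eq (leaves (Node (map tr (enum P)))) (enum A).
  apply/allP => i _ /=; rewrite [X in _ == X]count_uniq_mem ?enum_uniq // mem_enum.
  rewrite count_flatten -!map_comp sumnE big_map big_enum /=.
  rewrite (eq_bigr (fun B => \sum_(j in B) (j == i : nat))); last first.
    move=> B BP /=; have [/permP -> _ _] := trP B BP.
    by rewrite -sum1_count big_enum_cond /= big_mkcondr.
  rewrite -(big_trivIset _ tiP) covP -big_mkcondr /= sum1_card.
  have -> : #|(fun j : T => (j \in A) && (j == i))| = #|A :&: [set i]|.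
    by apply: eq_card => j; rewrite !inE.
  apply/eqP; case: (boolP (i \in A)) => iA.
    by rewrite (setIidPr _) ?sub1set // cards1.
  by apply/eqP; rewrite cards_eq0 setI_eq0 disjoint_sym disjoints1.
have trok B : B \in enum P -> outdegrees_ok k (tr B) by rewrite mem_enum => /trP[].
have P1 : 1 < #|P|.
  have /set0Pn[i iA] := A0; have iP : i \in cover P by rewrite covP.
  have BP := pblock_mem iP; have /properP[_ [j jA jB]] := PA _ BP.
  have jP : j \in cover P by rewrite covP.
  apply/card_gt1P; exists (pblock P i), (pblock P j); split=> //; first exact: pblock_mem.
  by apply: contraNneq jB => ->; rewrite mem_pblock.
exists (Node (map tr (enum P))); split=> //.
  rewrite /= size_map -cardE P1 -(card_tops_partition_of partP Xk) Ak eqxx all_map.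
  by apply/allP => B /trok.
apply/setP => C; rewrite in_set [map _ _]/= in_cons mem_map_internal_Node has_map.
have -> : cluster (Node (map tr (enum P))) = A.
  by apply/setP => i; rewrite inE (perm_mem permN) mem_enum.
apply/orP/idP => [[/eqP->|/hasP[B]]|CY]; first exact: AY.
  rewrite mem_enum => BP /=; have [_ _ /setP/(_ C)] := trP B BP.
  by rewrite !in_set => -> /andP[].
have [|CA] := eqVneq C A; [by left | right].
have CX : C \in X :|: [set [set i] | i in A] by rewrite !inE CA CY.
have [B BP CB] := tops_exists CX; apply/hasP; exists B; first by rewrite mem_enum.
have [_ _ /setP/(_ C)] := trP B BP.
by rewrite !in_set CY CB => /= ->.
Qed.

Lemma ktree_faceP k X : 0 < #|T| -> #|T| = 1 %[mod k] ->
  ktree_face k X <-> [/\ X != set0, laminar X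
    & {in X, forall C, kcluster k [set: T] C /\ C != [set: T]}].
Proof.
move=> T0 Tk; split=> [[X0 [t /andP[tT tok] XE]]|[X0 lX Xk]].
  have ut : uniq (leaves t) by rewrite (perm_uniq tT) enum_uniq.
  have tE : cluster t = [set: T].
    by apply/setP => i; rewrite !inE (perm_mem tT) mem_enum.
  have [_ _ lt tk] := internal_tree ut tok.
  have Xt C : C \in X -> C \in map (@cluster T) (internal t).
    rewrite XE inE /nonroot_internal.
    by case: (internalE t) => -> //=; rewrite in_cons orbC => ->.
  split=> //.
    by apply: laminarS lt; apply/subsetP => C CX; rewrite inE Xt.
  move=> C CX; rewrite -tE; split; first exact: tk (Xt C CX).
  have : C \in map (@cluster T) (nonroot_internal t) by move: CX; rewrite XE inE.
  by move/(nonroot_internal_proper ut tok); rewrite properEneq => /andP[].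
split=> //; have /set0Pn[C CX] := X0.
have T1 : 1 < #|[set: T]|.
  have [/and3P[C1 _ _] _] := Xk _ CX.
  by apply: leq_trans C1 _; rewrite cardsT max_card.
(* Faces omit the cluster of the root, so the full set is put back before a tree is built. *)
have [||||//|t [tT tok tX]] := @kcluster_tree_exists k [set: T] ([set: T] |: X).
- by rewrite -card_gt0 ltnW.
- by rewrite cardsT.
- by move=> B D /setU1P[->|BX] /setU1P[->|DX]; rewrite ?subsetT ?orbT //; apply: lX.
- move=> B /setU1P[->|/Xk[]//].
  by rewrite /kcluster T1 cardsT Tk subxx eqxx.
- by rewrite setU11.
have tE : cluster t = [set: T].
  by apply/setP => i; rewrite !inE (perm_mem tT) mem_enum inE.
exists t; first by rewrite /is_ktree tok andbT (perm_trans tT) // enumT /= enum_setT.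
have ut : uniq (leaves t) by rewrite (perm_uniq tT) enum_uniq.
have tE' : internal t = t :: nonroot_internal t.
  case: (internalE t) => // t0; have /setP/(_ setT) := tX.
  by rewrite t0 !inE eqxx.
apply/setP => D; have /setP/(_ D) := tX.
rewrite tE' !inE tE /= => DE.
have [DT|DT] := eqVneq D setT; last first.
  by move: DE; rewrite (negPf DT) orFb => ->.
apply/idP/idP => [/Xk[_]|/(nonroot_internal_proper ut tok)]; first by rewrite DT eqxx.
by rewrite tE DT properxx.
Qed.

End Laminar.

(** * Topology of geometric realizations *)

Section Realizations.
Variable R : realType.
Local Open Scope classical_set_scope.

(** Closed subsets of the compact [A] have compact, hence closed, images, so the inverse is
    continuous. The point [x0] serves as the value of the inverse outside [B]. *)
Lemma homeomorphism_of_compact (X Y : topologicalType) (A : set X) (B : set Y)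
    (f : X -> Y) (x0 : X) : compact A -> hausdorff_space Y ->
  {within A, continuous f} -> set_bij A B f -> homeomorphism A B f.
Proof.
move=> cA hY cf [fAB finj fsurj]; split=> //.
have /choice[g gP] : forall y, exists x, B y -> A x /\ f x = y.
  move=> y; have [By|] := pselect (B y); last by exists x0.
  by have [x Ax <-] := fsurj y By; exists x.
have fK : {in A, cancel f g}.
  move=> x /set_mem Ax; have [Ag fg] := gP _ (fAB _ Ax).
  by apply: finj => //; exact: mem_set.
exists g; split=> [y By||//|y /set_mem By]; [by have [] := gP y By| |by have [] := gP y By].
apply/continuous_closedP => C clC; apply/closed_subspaceP.
exists (f @` (A `&` C)).
  apply: compact_closed => //; apply: continuous_compact.
    by apply: continuous_subspaceW cf => x [].
  exact: compact_closedI.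
apply/seteqP; split=> y [].
  move=> [x [Ax Cx] <-] By; split=> //; change (C (g (f x))).
  by rewrite fK //; exact: mem_set.
move=> Cy By; have [Ax fy] := gP _ By; split=> //.
by exists (g y).
Qed.

Section Complex.
Variables (V W : finType) (P : simplicial_complex V).
Implicit Type x : {ptws V -> R}.

Lemma coord_continuous (v : V) : continuous (fun x : {ptws V -> R} => x v : R).
Proof. exact: (@proj_continuous V (fun=> R) v). Qed.

Lemma closed_coord (v : V) (A : set R) :
  topology_structure.closed A ->
  topology_structure.closed [set x : {ptws V -> R} | A (x v)].
Proof. by move=> clA; apply: (continuous_closedP _).1 (@coord_continuous v) _ clA. Qed.

Lemma continuous_fsum (X : topologicalType) (I : finType) (F : I -> X -> R) :
  (forall i, continuous (F i)) -> continuous (fun z => \sum_i F i z).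
Proof.
move=> cF z; rewrite /continuous_at; elim: (index_enum I) => [|i s IHs].
  under eq_fun do rewrite big_nil; rewrite big_nil; exact: cvg_cst.
under eq_fun do rewrite big_cons; rewrite big_cons; apply: cvgD IHs; exact: cF.
Qed.

(** A finite union of closed simplices, each closed in the unit cube, which is compact by
    Tychonoff. *)
Lemma compact_realization : compact (realization R P).
Proof.
have -> : realization R P =
    \big[classical_sets.setU/classical_sets.set0]_(s <- enum {: {set V}} | `[< P s >])
      closed_simplex R s.
  rewrite -bigcup_seq_cond; apply/seteqP; split=> x [s /= Ps xs]; exists s => //=.
    by rewrite mem_enum; apply/asboolP.
  by case/andP: Ps => _ /asboolP.
apply: bigsetU_compact => s _.
apply: (@subclosed_compact _ _ [set x : {ptws V -> R} | forall v, `[0, 1] (x v)]).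
- have -> : closed_simplex R s = [set x | forall v, 0 <= x v]
      `&` [set x | \sum_v x v = 1] `&` [set x | forall v, v \notin s -> x v = 0].
    by apply/seteqP; split=> x; [case=> ? ? ?; split=> //; split | case=> -[]].
  apply: closedI; first apply: closedI.
  + rewrite (_ : [set x | _] = \bigcap_v [set x | 0 <= x v]); last first.
      by apply/seteqP; split=> x /= x0 v => [_|]; apply: x0.
    apply: closed_bigI => v _.
    exact: (@closed_coord v [set r | 0 <= r] (@closed_ge _ 0)).
  + apply: ((continuous_closedP _).1 _ [set r : R | r = 1] (@closed_eq _ 1)).
    exact: (continuous_fsum (@coord_continuous)).
  + rewrite (_ : [set x | _] = \bigcap_(v in [set v | v \notin s]) [set x | x v = 0]).
      apply: closed_bigI => v _.
      exact: (closed_coord (A := [set r | r = 0]) (@closed_eq _ 0)).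
    by apply/seteqP; split=> x /= x0 v; apply: x0.
- by apply: (@tychonoff V (fun=> R) (fun=> `[0, 1])) => v; exact: segment_compact.
- move=> x [x0 x1 _] v; rewrite /= in_itv /= x0 -x1 (bigD1 v) //= lerDl.
  by apply: sumr_ge0.
Qed.

(** The product topology is the supremum of the topologies induced by the coordinates, so
    convergence is tested one coordinate at a time. *)
Lemma ptws_continuous (X : topologicalType) (f : X -> {ptws W -> R}) :
  (forall w, continuous (fun y => f y w : R)) -> continuous f.
Proof.
move=> cf z.
apply: (iffRL (@cvg_sup _ W
  (fun w => Topological.class (initial_topology (fun f : W -> R => f w))) _ _ _)).
move=> w U [B [[C oC <-] Cz CU]].
have nC : nbhs z [set y | C (f y w)] by apply: (cf w z); apply: open_nbhs_nbhs.
exact: (@filterS _ (nbhs z) _ _ _ (fun y Cy => CU _ Cy) nC).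
Qed.

Lemma affine_extension_continuous (f0 : V -> {ptws W -> R}) :
  continuous (affine_extension f0).
Proof.
have scale (X : topologicalType) (h : X -> R) c :
    continuous h -> continuous (fun z => h z * c : R).
  by move=> ch z; apply: cvgMr_tmp; exact: ch.
apply: ptws_continuous => w.
exact: (continuous_fsum (fun v => scale _ _ (f0 v w) (@coord_continuous v))).
Qed.

(** The support of a point is contained in every face carrying it, and is nonempty because the
    coordinates sum to 1. *)
Lemma realizationP x : realization R P x <->
  [/\ forall v, 0 <= x v, \sum_v x v = 1 & P [set v | x v != 0]%SET].
Proof.
split=> [[s /= Ps [x0 x1 xs]]|[x0 x1 Px]]; last first.
  exists [set v | x v != 0]%SET => //; split=> // v.
  by rewrite inE negbK => /eqP.
split=> //; apply: face_sub Ps _ _.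
  apply/fintype.subsetP => v; rewrite inE; apply: contraNT => /xs ->.
  exact: eqxx.
apply: contraPneq x1 => xs0; rewrite big1 => [/eqP|v _]; first by rewrite eq_sym oner_eq0.
by apply/eqP; apply: contraT => xv; have := in_set0 v; rewrite -xs0 inE xv.
Qed.

End Complex.
End Realizations.

(** * Partitions described by their nontrivial blocks *)

Section NontrivialBlocks.
Variables k m : nat.
Hypotheses (m_gt0 : (0 < m)%N) (m_mod : m = 1 %[mod k]).
Implicit Types (P Q : kpartition k m) (B C : {set 'I_m}) (X : {set {set 'I_m}}).
Local Open Scope nat_scope.
Local Open Scope set_scope.

Definition nontrivial_blocks P : {set {set 'I_m}} := [set B in blocks P | 1 < #|B|].

Local Notation nb := nontrivial_blocks.

Lemma blocks_cover P i : exists2 B, B \in blocks P & i \in B.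
Proof.
have /andP[/cover_partition Pc _] := blocksP P.
have : i \in cover (blocks P) by rewrite Pc inE.
by case/bigcupP => B BP iB; exists B.
Qed.

Lemma block_neq0 P B : B \in blocks P -> B != set0.
Proof.
have /andP[/and3P[_ _ P0] _] := blocksP P.
by move=> BP; apply: contraNneq P0 => <-.
Qed.

Lemma block_eq_or_disjoint P B C : B \in blocks P -> C \in blocks P ->
  B = C \/ [disjoint B & C].
Proof.
have /andP[/and3P[_ /trivIsetP tP _] _] := blocksP P => BP CP.
by have [|/(tP _ _ BP CP)] := eqVneq B C; [left|right].
Qed.

Lemma trivial_block P B : B \in blocks P -> B \notin nb P -> exists i, B = [set i].
Proof.
move=> BP; rewrite inE BP /= -leqNgt => B1; apply/cards1P.
by rewrite eqn_leq B1 card_gt0 (block_neq0 BP).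
Qed.

(** A singleton block always lies in some block of [Q]. *)
Lemma nontrivial_refines P Q :
  (forall B, B \in nb P -> exists2 C, C \in blocks Q & B \subset C) -> (P <= Q)%O.
Proof.
move=> PQ; apply/refinesP => B BP.
case: (boolP (B \in nb P)) => [/PQ //|/(trivial_block BP)[i ->]].
by have [C CQ iC] := blocks_cover Q i; exists C; rewrite ?sub1set.
Qed.

Lemma nontrivial_blocks_inj : injective nb.
Proof.
move=> P Q PQ; apply: le_anti; apply/andP; split; apply: nontrivial_refines => B.
  by rewrite PQ inE => /andP[BQ _]; exists B.
by rewrite -PQ inE => /andP[BP _]; exists B.
Qed.

Lemma proper_partE P :
  (P \in proper_part (kpartition k m)) = (nb P != set0) && (setT \notin blocks P).
Proof.
rewrite inE; congr (~~ _ && ~~ _); apply/idP/idP.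
- move/forallP/kpartition_leastP => PE; apply/eqP/setP => B; rewrite !inE PE.
  by apply/negP => /andP[/imsetP[i _ ->]]; rewrite cards1.
- move/eqP => P0; apply/forallP => Q; apply: nontrivial_refines => B.
  by rewrite P0 inE.
- by move/forallP/(kpartition_greatestP _ m_gt0 m_mod) => ->; rewrite inE.
- by move=> PT; apply/forallP => Q; apply/refinesP => B _; exists setT.
Qed.

Lemma nontrivial_blocks_kcluster P : P \in proper_part (kpartition k m) ->
  {in nb P, forall B, kcluster k [set: 'I_m] B /\ B != [set: 'I_m]}.
Proof.
rewrite proper_partE => /andP[_ PT] B; rewrite inE => /andP[BP B1].
have /andP[_ /'forall_implyP Pk] := blocksP P; split.
  by rewrite /kcluster B1 subsetT (Pk _ BP).
by apply: contraNneq PT => <-.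
Qed.

(** The block of [Q] that contains [B] either is [C] or is disjoint from it. *)
Lemma le_blocks P Q B C : (P <= Q)%O -> B \in blocks P -> C \in blocks Q ->
  B \subset C \/ [disjoint B & C].
Proof.
move=> /refinesP PQ /PQ[D DQ BD] CQ.
have [<-|DC] := block_eq_or_disjoint DQ CQ; first by left.
by right; apply: disjointWl BD DC.
Qed.

Lemma chain_laminar (s : {set kpartition k m}) :
  {in s &, forall P Q, (P >=< Q)%O} -> laminar (\bigcup_(P in s) nb P).
Proof.
move=> sC B C /bigcupP[P Ps BP] /bigcupP[Q Qs CQ].
move: BP CQ; rewrite !inE => /andP[BP _] /andP[CQ _].
case/orP: (sC _ _ Ps Qs) => [/le_blocks/(_ BP CQ)|/le_blocks/(_ CQ BP)] [->|d] //.
- by rewrite d !orbT.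
- by rewrite orbT.
- by rewrite disjoint_sym d !orbT.
Qed.

(** Provides the top of the chain to be rebuilt from [X]. It is not minimal since [X] is nonempty,
    and not maximal since the full set is not in [X]. *)
Lemma tops_kpartition X : X != set0 -> laminar X ->
  {in X, forall C, kcluster k [set: 'I_m] C /\ C != [set: 'I_m]} ->
  exists2 P, P \in proper_part (kpartition k m) & nb P = tops X.
Proof.
move=> /set0Pn[C0 C0X] lX Xk.
have pX : partition (tops_partition_of [set: 'I_m] X) setT.
  apply: tops_partition_ofP => // C /Xk[/and3P[C1 _ _] _]; rewrite subsetT; split=> //.
  by rewrite -card_gt0 ltnW.
have kX : is_kpartition k (tops_partition_of [set: 'I_m] X).
  rewrite /is_kpartition pX /=; apply/'forall_implyP => B /topsP[+ _].
  by case/setUP => [/Xk[/and3P[]] //|/imsetP[i _ ->]]; rewrite cards1.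
have nbE : nb (KPartition kX) = tops X.
  apply/setP => B; rewrite inE /=; have [B1|B1] := ltnP 1 #|B|.
    by rewrite andbT tops_partition_ofE.
  rewrite andbF; apply/esym/negP => /topsP[/Xk[/and3P[C1 _ _] _] _].
  by rewrite ltnNge B1 in C1.
exists (KPartition kX) => //; rewrite proper_partE nbE; apply/andP; split.
  by have [B BX _] := tops_exists C0X; apply/set0Pn; exists B.
apply/negP => /= TX; have [/and3P[C1 _ _] CT] := Xk _ C0X.
have T1 : 1 < #|[set: 'I_m]| := leq_trans C1 (subset_leq_card (subsetT C0)).
by move: TX; rewrite tops_partition_ofE // => /topsP[/Xk[_]]; rewrite eqxx.
Qed.

(** * Weights on chains and the induced weights on clusters *)

Section ChainWeights.
Variable R : realType.
Implicit Types (y z : kpartition k m -> R) (x : {set 'I_m} -> R).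
Local Open Scope ring_scope.

Definition supp (V : finType) (f : V -> R) : {set V} := [set v | f v != 0].

Lemma eq_supp0 (V : finType) (f g : V -> R) : supp f = set0 -> supp g = set0 -> f =1 g.
Proof.
have H (h : V -> R) : supp h = set0 -> forall v, h v = 0.
  by move=> /setP h0 v; apply/eqP; have := h0 v; rewrite !inE => /negbFE.
by move=> /H f0 /H g0 v; rewrite f0 g0.
Qed.

Lemma eq_supp (V : finType) (f g : V -> R) : f =1 g -> supp f = supp g.
Proof. by move=> fg; apply/setP => v; rewrite !inE fg. Qed.

Definition chain_weight y : Prop :=
  [/\ forall P, 0 <= y P, supp y \subset proper_part (kpartition k m)
    & {in supp y &, forall P Q, (P >=< Q)%O}].

(** The affine extension of the vertex map without the division by the number of blocks, which
    simplifies subtracting weight from a single partition. *)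
Definition cluster_weight y C : R := \sum_P y P * (C \in nb P)%:R.

Lemma cluster_weight_ge0 y C : (forall P, 0 <= y P) -> 0 <= cluster_weight y C.
Proof. by move=> y0; apply: sumr_ge0 => P _; rewrite mulr_ge0. Qed.

(** Nonnegative terms cannot cancel. *)
Lemma supp_cluster_weight y : (forall P, 0 <= y P) ->
  supp (cluster_weight y) = \bigcup_(P in supp y) nb P.
Proof.
move=> y0; apply/setP => C; rewrite inE psumr_eq0; last by move=> P _; rewrite mulr_ge0.
rewrite -has_predC; apply/hasP/bigcupP => [[P _ /=]|[P]].
  by rewrite mulf_eq0 negb_or pnatr_eq0 eqb0 negbK => /andP[yP CP]; exists P => //; rewrite inE.
rewrite inE => yP CP; exists P; first by rewrite mem_index_enum.
by rewrite /= CP mulr1.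
Qed.

(** Take [P] with the most elements of [s] below it. If [P] is below [Q], the down-set of [P] lies
    in that of [Q], and by maximality they agree, so [Q] is below [P]. *)
Lemma chain_top (s : {set kpartition k m}) :
  s != set0 -> {in s &, forall P Q, (P >=< Q)%O} ->
  exists2 P, P \in s & {in s, forall Q, (Q <= P)%O}.
Proof.
move=> /set0Pn[P0 P0s] sC.
have [P Ps Pmax] : exists2 P, P \in s &
    forall Q, Q \in s -> (#|[set S in s | (S <= Q)%O]| <= #|[set S in s | (S <= P)%O]|)%N.
  by case: (arg_maxnP (fun P => #|[set S in s | (S <= P)%O]|) P0s) => P Ps Pmax; exists P.
exists P => // Q Qs; case/orP: (sC _ _ Ps Qs) => // PQ.
have sub : [set S in s | (S <= P)%O] \subset [set S in s | (S <= Q)%O].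
  by apply/subsetP => S; rewrite !inE => /andP[-> SP]; exact: le_trans SP PQ.
have /eqP/setP/(_ Q) : [set S in s | (S <= P)%O] == [set S in s | (S <= Q)%O].
  by rewrite eqEcard sub Pmax.
by rewrite !inE Qs lexx.
Qed.

Definition subtract_at y P c : kpartition k m -> R := fun Q => y Q - c * (Q == P)%:R.

Lemma cluster_weight_subtract_at y P c C :
  cluster_weight (subtract_at y P c) C = cluster_weight y C - c * (C \in nb P)%:R.
Proof.
rewrite /cluster_weight (eq_bigr (fun Q => y Q * (C \in nb Q)%:R
    - c * (Q == P)%:R * (C \in nb Q)%:R)); last by move=> Q _; rewrite mulrBl.
rewrite sumrB; congr (_ - _); rewrite (bigD1 P) //= eqxx mulr1 big1 ?addr0 // => Q.
by move/negPf ->; rewrite mulr0 mul0r.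
Qed.

Lemma chain_weight_subtract_at y P c : c <= y P -> 0 <= c -> chain_weight y ->
  supp (subtract_at y P c) \subset supp y /\ chain_weight (subtract_at y P c).
Proof.
move=> cy c0 [y0 yP yC].
have sub : supp (subtract_at y P c) \subset supp y.
  apply/subsetP => Q; rewrite !inE; apply: contraNneq => yQ; rewrite /subtract_at yQ.
  case: (Q =P P) => [QP|_]; last by rewrite mulr0 subrr.
  suff -> : c = 0 by rewrite mul0r subrr.
  by apply/eqP; rewrite eq_le c0 andbT -yQ QP.
split=> //; split.
- move=> Q; rewrite /subtract_at; case: eqP => [->|_]; first by rewrite mulr1 subr_ge0.
  by rewrite mulr0 subr0.
- exact: subset_trans sub yP.
- by move=> Q S /(subsetP sub) Qy /(subsetP sub); apply: yC.
Qed.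

(** Equal cluster weights have equal supports, so each nontrivial block of [P] is a block of a
    partition in the support of [z], hence lies in a block of [Q]. *)
Lemma chain_weight_top_le y z P Q : chain_weight y -> chain_weight z ->
  cluster_weight y =1 cluster_weight z ->
  P \in supp y -> {in supp z, forall S, (S <= Q)%O} -> (P <= Q)%O.
Proof.
move=> [y0 _ _] [z0 _ _] yz Py Qtop; apply: nontrivial_refines => B BP.
have : B \in supp (cluster_weight z).
  by rewrite -(eq_supp yz) supp_cluster_weight //; apply/bigcupP; exists P.
rewrite supp_cluster_weight // => /bigcupP[S Sz].
by rewrite inE => /andP[BS _]; have /refinesP/(_ _ BS) := Qtop _ Sz.
Qed.

Lemma chain_weight_eq0 y : chain_weight y -> (supp (cluster_weight y) == set0) = (supp y == set0).
Proof.
move=> [y0 yP _]; rewrite supp_cluster_weight //; apply/eqP/eqP => [b0|->]; last first.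
  by rewrite big_set0.
apply/eqP; apply: contraT => /set0Pn[P Py]; have := subsetP yP _ Py.
rewrite proper_partE => /andP[/set0Pn[B BP] _].
have : B \in \bigcup_(P in supp y) nb P by apply/bigcupP; exists P.
by rewrite b0 inE.
Qed.

(* The top of the chain is read off the maximal clusters of positive weight;
   subtract the smaller of the two weights of the top and repeat. *)
Lemma cluster_weight_inj y z : chain_weight y -> chain_weight z ->
  cluster_weight y =1 cluster_weight z -> y =1 z.
Proof.
(* The smaller weight of the top may belong to [y] or to [z], so the induction counts both supports
   together. *)
have [n] := ubnP (#|supp y| + #|supp z|)%N; elim: n => // n IHn in y z *.
rewrite ltnS => yzn cy cz yz.
have s0 : (supp y == set0) = (supp z == set0).
  by rewrite -!chain_weight_eq0 // (eq_supp yz).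
have [y0|y0] := eqVneq (supp y) set0.
  by apply: eq_supp0 => //; apply/eqP; rewrite -s0 y0.
have z0 : supp z != set0 by rewrite -s0.
have [[yp _ yC] [zp _ zC]] := (cy, cz).
have [P Py Ptop] := chain_top y0 yC; have [Q Qz Qtop] := chain_top z0 zC.
have PQ : P = Q.
  apply: le_anti; rewrite (chain_weight_top_le cy cz yz Py Qtop) /=.
  exact: (chain_weight_top_le cz cy (fsym yz) Qz Ptop).
subst Q; pose c := Num.min (y P) (z P).
have c0 : 0 <= c by rewrite le_min yp zp.
have [cyP czP] : c <= y P /\ c <= z P by rewrite !ge_min !lexx orbT.
have [sy cy'] := chain_weight_subtract_at cyP c0 cy.
have [sz cz'] := chain_weight_subtract_at czP c0 cz.
have P0 : (P \notin supp (subtract_at y P c)) || (P \notin supp (subtract_at z P c)).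
  rewrite !inE !negbK /subtract_at eqxx mulr1 !subr_eq0 /c.
  by case: (leP (y P) (z P)) => _; rewrite eqxx ?orbT.
have lt : (#|supp (subtract_at y P c)| + #|supp (subtract_at z P c)| < n)%N.
  apply: leq_trans yzn; case/orP: P0 => P0.
    by rewrite -addSn leq_add ?subset_leq_card // proper_card // properE sy;
      apply/subsetPn; exists P.
  by rewrite -addnS leq_add ?subset_leq_card // proper_card // properE sz;
    apply/subsetPn; exists P.
have {}IHn := IHn _ _ lt cy' cz' _.
have yz' : cluster_weight (subtract_at y P c) =1 cluster_weight (subtract_at z P c).
  by move=> C; rewrite !cluster_weight_subtract_at yz.
by move=> S; have /addIr := IHn yz' S.
Qed.

(* Peel off the maximal clusters, all with the smallest of their weights: they
   form the top partition of the chain. *)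
Lemma cluster_weight_surj x : (forall C, 0 <= x C) -> laminar (supp x) ->
  {in supp x, forall C, kcluster k [set: 'I_m] C /\ C != [set: 'I_m]} ->
  exists2 y, chain_weight y & cluster_weight y =1 x.
Proof.
have [n] := ubnP #|supp x|; elim: n => // n IHn in x *.
rewrite ltnS => xn x0 lx kx.
have [xs|xs] := eqVneq (supp x) set0.
  have s0 : supp (fun _ : kpartition k m => 0 : R) = set0.
    by apply/setP => P; rewrite !inE eqxx.
  exists (fun=> 0); first by split=> [//||P Q]; rewrite s0 ?sub0set ?inE.
  apply: eq_supp0 => //; rewrite supp_cluster_weight //.
  by rewrite s0 big_set0.
have [P Pp PE] := tops_kpartition xs lx kx.
have topX B : B \in nb P -> B \in supp x by rewrite PE => /topsP[].
have /andP[/set0Pn[B0 B0P] _] : (nb P != set0) && (setT \notin blocks P).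
  by rewrite -proper_partE.
(* Removing the minimal weight keeps all weights nonnegative and takes [B1] itself out of the
   support, so the support shrinks. *)
pose B1 := [arg min_(B < B0 in nb P) x B]%O.
have [B1P B1min] : B1 \in nb P /\ forall B, B \in nb P -> x B1 <= x B.
  by rewrite /B1; case: arg_minP.
pose x' C := x C - x B1 * (C \in nb P)%:R.
have sub : supp x' \subset supp x.
  apply/subsetP => C; rewrite [C \in supp x]inE; apply: contraTneq => xC.
  have /negPf CP : C \notin nb P by apply/negP => /topX; rewrite inE xC eqxx.
  by rewrite inE /x' CP xC mulr0 subrr eqxx.
have x'0 C : 0 <= x' C.
  rewrite /x'; case: (boolP (C \in nb P)) => [/B1min|_]; first by rewrite mulr1 subr_ge0.
  by rewrite mulr0 subr0.
have [||C /(subsetP sub)|y [y0 yP yC] yE] := IHn x' _ x'0.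
- apply: leq_trans xn; apply: proper_card; rewrite properE sub; apply/subsetPn.
  by exists B1; [exact: topX|rewrite inE /x' B1P mulr1 subrr eqxx].
- exact: laminarS lx.
- exact: kx.
(* Blocks of [Q] carry positive weight in [x'], hence in [x], so each lies under a maximal member of
   [supp x], which is a block of [P]. Adding [P] therefore preserves the chain. *)
have below Q : Q \in supp y -> (Q <= P)%O.
  move=> Qy; apply: nontrivial_refines => B BQ.
  have : B \in supp x.
    apply: (subsetP sub); rewrite -(eq_supp yE) supp_cluster_weight //.
    by apply/bigcupP; exists Q.
  case/tops_exists => C; rewrite -PE inE => /andP[CP _] BC; by exists C.
have x10 : 0 <= x B1 by [].
pose z Q := y Q + x B1 * (Q == P)%:R.
have zsupp Q : Q \in supp z -> Q = P \/ Q \in supp y.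
  by rewrite !inE /z; have [->|_] := eqVneq Q P; [left|rewrite mulr0 addr0; right].
exists z; first split.
- by move=> Q; rewrite addr_ge0 // mulr_ge0.
- by apply/subsetP => Q /zsupp[->//|/(subsetP yP)].
- move=> Q S /zsupp[->|Qy] /zsupp[->|Sy].
  + exact: comparablexx.
  + by rewrite /Order.comparable below ?orbT.
  + by rewrite /Order.comparable below.
  + exact: yC.
move=> C; have -> : x C = x' C + x B1 * (C \in nb P)%:R by rewrite subrK.
rewrite -yE /cluster_weight /z; under eq_bigr do rewrite mulrDl.
rewrite big_split /=; congr (_ + _).
rewrite (bigD1 P) //= eqxx mulr1 big1 ?addr0 // => Q.
by move/negPf ->; rewrite mulr0 mul0r.
Qed.

(** * The barycenter map and the subdivision *)

(** The partition into singletons gets the zero function; it is not a vertex of the order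
    complex. *)
Definition block_barycenter (P : kpartition k m) : {ptws {set 'I_m} -> R} :=
  fun C => (C \in nb P)%:R / #|nb P|%:R.

Lemma sum_nontrivial_blocks P : \sum_C (C \in nb P)%:R = #|nb P|%:R :> R.
Proof. by rewrite -natr_sum -sum1_card [in RHS]big_mkcond. Qed.

Lemma affine_extension_block_barycenter (l : {ptws kpartition k m -> R}) :
  affine_extension block_barycenter l = cluster_weight (fun P => l P / #|nb P|%:R).
Proof.
apply/funext => C; apply: eq_bigr => P _.
by rewrite /block_barycenter -mulrA; congr (_ * _); rewrite mulrC.
Qed.

(** Double counting of pairs of a partition and one of its nontrivial blocks; it matches the
    normalizations to total 1 on both sides. *)
Lemma sum_cluster_weight y :
  \sum_C cluster_weight y C = \sum_P y P * #|nb P|%:R.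
Proof.
rewrite exchange_big; apply: eq_bigr => P _.
by rewrite -mulr_sumr sum_nontrivial_blocks.
Qed.

Lemma card_nontrivial_blocks_neq0 P : P \in proper_part (kpartition k m) ->
  #|nb P|%:R != 0 :> R.
Proof. by rewrite proper_partE pnatr_eq0 cards_eq0 => /andP[]. Qed.

Section Subdivision.
(** The tree complex enters only through the laminar description of its faces. *)
Variable Q : simplicial_complex {set 'I_m}.
Hypothesis QP : forall X, Q X <-> [/\ X != set0, laminar X
  & {in X, forall C, kcluster k [set: 'I_m] C /\ C != [set: 'I_m]}].

Let O := order_complex (kpartition k m).
Let phi (s : {set kpartition k m}) := \bigcup_(P in s) nb P.

Lemma chain_clusters_face s : O s -> Q (phi s).
Proof.
move=> [/set0Pn[P Ps] sP sC]; apply/QP; split; last 2 first.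
- exact: chain_laminar.
- by move=> C /bigcupP[S /(subsetP sP)/nontrivial_blocks_kcluster]; apply.
have := subsetP sP _ Ps; rewrite proper_partE => /andP[/set0Pn[B BP] _].
by apply/set0Pn; exists B; apply/bigcupP; exists P.
Qed.

Lemma block_barycenter_in_simplex s P : O s -> P \in s ->
  closed_simplex R (phi s) (block_barycenter P).
Proof.
move=> [_ sP _] Ps; split=> [C||C Cphi].
- by rewrite /block_barycenter divr_ge0.
- rewrite -mulr_suml sum_nontrivial_blocks divff //.
  exact/card_nontrivial_blocks_neq0/(subsetP sP).
- rewrite /block_barycenter; case: (boolP (C \in nb P)) => CP; last by rewrite mul0r.
  by case/negP: Cphi; apply/bigcupP; exists P.
Qed.

(** Proper partitions have nontrivial blocks, so dividing by their number does not change the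
    support. *)
Lemma realization_chain_weight (l : {ptws kpartition k m -> R}) :
  realization R O l ->
  chain_weight (fun P => l P / #|nb P|%:R)
  /\ supp (fun P => l P / #|nb P|%:R) = supp l.
Proof.
move=> /realizationP[l0 _ [_ lP lC]].
have sE : supp (fun P => l P / #|nb P|%:R) = supp l.
  apply/setP => P; rewrite !inE mulf_eq0 invr_eq0 negb_or.
  case: (boolP (l P == 0)) => //= lP0; apply: card_nontrivial_blocks_neq0.
  by apply: (subsetP lP); rewrite inE.
split=> //; split; rewrite ?sE // => P.
by rewrite divr_ge0.
Qed.

Lemma affine_extension_bij :
  set_bij (realization R O) (realization R Q) (affine_extension block_barycenter).
Proof.
split.
- move=> l lO; have [cl sl] := realization_chain_weight lO.
  have /realizationP[l0 l1 lface] := lO; have [y0 _ _] := cl.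
  rewrite /= affine_extension_block_barycenter; apply/realizationP; split.
  + by move=> C; apply: cluster_weight_ge0.
  + rewrite sum_cluster_weight -[RHS]l1; apply: eq_bigr => P _.
    have [->|lP] := eqVneq (l P) 0; first by rewrite !mul0r.
    rewrite divfK // card_nontrivial_blocks_neq0 //.
    by have [_ /subsetP-> //] := lface; rewrite inE.
  + have := supp_cluster_weight y0; rewrite sl /supp => ->.
    exact: chain_clusters_face.
- move=> l l' /set_mem lO /set_mem lO' /=.
  rewrite !affine_extension_block_barycenter => E.
  have [cl sl] := realization_chain_weight lO.
  have [cl' sl'] := realization_chain_weight lO'.
  have ll' := cluster_weight_inj cl cl' (fun C => congr1 (fun f => f C) E).
  have sll' : supp l = supp l' by rewrite -sl -sl' (eq_supp ll').
  apply/funext => P; have [lP|lP] := boolP (P \in supp l).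
    have r0 : #|nb P|%:R != 0 :> R.
      have [_ lp _] := cl; apply: card_nontrivial_blocks_neq0.
      by apply: (subsetP lp); rewrite sl.
    by apply: (mulIf (invr_neq0 r0)); apply: ll'.
  have := lP; rewrite sll'; move: lP.
  by rewrite !inE !negbK => /eqP-> /eqP->.
- move=> x /realizationP[x0 x1 /QP[_ lx kx]].
  have [y cy yx] := cluster_weight_surj x0 lx kx; have [y0 yP yC] := cy.
  (* Multiplying by the block count undoes the scaling and, by [sum_cluster_weight], makes the
     coordinates sum to 1. *)
  pose l : {ptws kpartition k m -> R} := fun P => y P * #|nb P|%:R.
  have lsub : supp l \subset supp y.
    by apply/subsetP => P; rewrite !inE /l mulf_eq0 negb_or => /andP[].
  have l1 : \sum_P l P = 1.
    by rewrite -sum_cluster_weight -x1; apply: eq_bigr => C _; apply: yx.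
  exists l.
    apply/realizationP; split=> // [P|]; first by rewrite mulr_ge0.
    split.
    + apply/negP => /eqP l0; have /eqP := l1; rewrite big1 ?[0 == _]eq_sym ?oner_eq0 // => P _.
      by apply/eqP; have /setP/(_ P) := l0; rewrite !inE => /negbFE.
    + exact: subset_trans lsub yP.
    + by move=> P S /(subsetP lsub) Py /(subsetP lsub); apply: yC.
  rewrite affine_extension_block_barycenter; apply/funext => C; rewrite -yx.
  apply: eq_bigr => P _; congr (_ * _); rewrite /l.
  have [->|yP0] := eqVneq (y P) 0; first by rewrite !mul0r.
  by rewrite mulfK // card_nontrivial_blocks_neq0 // (subsetP yP) // inE.
Qed.

Lemma order_complex_subdivision : is_subdivision R O Q.
Proof.
exists phi, block_barycenter; split.
- split=> [|p q _ _ pq]; first exact: chain_clusters_face.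
  by apply/bigcupsP => P Pp; apply: bigcup_sup; apply: (subsetP pq).
- move=> P PO; exists (phi [set P]); first exact: chain_clusters_face.
  by apply: block_barycenter_in_simplex; rewrite ?inE.
- move=> P S /set_mem[_ /subsetP PO _] /set_mem[_ /subsetP SO _] PS.
  (* The nonzero coordinates of the barycenter are the nontrivial blocks, which determine the
     partition. *)
  have nbE T C : T \in proper_part (kpartition k m) ->
      (C \in nb T) = (block_barycenter T C != 0).
    move=> /card_nontrivial_blocks_neq0 r0.
    by rewrite mulf_eq0 invr_eq0 (negPf r0) orbF pnatr_eq0 eqb0 negbK.
  apply: nontrivial_blocks_inj; apply/setP => C.
  have PP : P \in proper_part (kpartition k m) by apply: PO; rewrite inE.
  have SP : S \in proper_part (kpartition k m) by apply: SO; rewrite inE.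
  by rewrite !nbE // PS.
- by move=> p pO P Pp; apply: block_barycenter_in_simplex.
- apply: (@homeomorphism_of_compact {ptws kpartition k m -> R} {ptws {set 'I_m} -> R}
    _ _ _ (fun=> 0)).
  + exact: compact_realization.
  + exact: (@hausdorff_product _ (fun=> R) (fun=> @Rhausdorff R)).
  + exact/continuous_subspaceT/affine_extension_continuous.
  + exact: affine_extension_bij.
Qed.

End Subdivision.
End ChainWeights.
End NontrivialBlocks.

Theorem mainTheorem1 (R : realType) (k n : nat) (k_gt0 : (0 < k)%N)
    (n_gt0 : (0 < n)%N) :
  is_subdivision R (order_complex (kpartition k ((n - 1) * k + 1)))
    (ktree_complex k n).
Proof.
have m_gt0 : (0 < (n - 1) * k + 1)%N by rewrite addn1.
have m_mod : ((n - 1) * k + 1 = 1 %[mod k])%N by rewrite modnMDl.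
apply: (order_complex_subdivision m_gt0 m_mod) => X.
by apply: ktree_faceP; rewrite card_ord.
Qed.
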